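(* Let $d$ be a positive integer and suppose that $-1\le\beta<\alpha<1$ and $\beta<0$. Put $$f(\alpha,\beta,d)=\max\left\{N\left(d,\frac{\alpha-\beta}{\alpha^2-\beta},\frac{1-\beta}{\alpha-\beta}\right),\ N^*\left(d,\frac{\alpha-\beta}{\alpha^2-\beta},\frac{1-\beta}{\alpha-\beta}\right)\right\},\qquad \alpha_0=\frac{\alpha}{1+\alpha},\qquad \beta_0=\frac{\beta-\alpha^2}{1-\alpha^2}.$$ Then $$N_{\alpha,\beta}(d)\le\frac{\alpha-\beta}{-\beta}\left(f(\alpha,\beta,d)+\frac{1-\beta}{\alpha-\beta}\right)\qquad\text{and}\qquad f(\alpha,\beta,d)\le N_{\alpha_0,\beta_0}(d).$$
   Context: For real numbers $b<a<1$, a spherical $\{a,b\}$-code in $\mathbb{R}^d$ is a set $S$ of unit vectors in $\mathbb{R}^d$ such that $x^\top y\in\{a,b\}$ for any two distinct $x,y\in S$ (it is allowed that only one, or neither, of the values occurs), and $N_{a,b}(d)$ is the maximum size of such a code. Graphs are finite and simple. ${\rm j}$ is the all-ones column vector and $R(M)$ is the column space of $M$. The group inverse $M^\#$ of a square matrix $M$ is the (unique, if it exists) matrix $X$ with $MXM=M$, $XMX=X$, $MX=XM$; it exists for every real symmetric matrix. For $p>0$, $\mu>1$ and a positive integer $r$, $N(r,p,\mu)$ (respectively $N^*(r,p,\mu)$) denotes the maximum number of vertices in a graph $G$ with adjacency matrix $A$ such that the smallest eigenvalue of $A$ is at least $-\mu$, ${\rm j}\in R(A+\mu I)$, $\mathrm{rank}(A+\mu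 I)\le r$, and ${\rm j}^\top(A+\mu I)^\#{\rm j}<p$ (respectively ${\rm j}^\top(A+\mu I)^\#{\rm j}=p$); if no such graph exists, the value is taken to be $0$. *)

(* Defs.v *)
From HB Require Import structures.
From mathcomp Require Import all_boot all_order all_algebra finmap.
From mathcomp Require Import boolp classical_sets reals.

Set Implicit Arguments.
Unset Strict Implicit.
Unset Printing Implicit Defensive.

Import Order.TTheory GRing.Theory Num.Theory.
Local Open Scope ring_scope.

Definition is_max (P : nat -> Prop) (n : nat) : Prop :=
  P n /\ forall m, P m -> (m <= n)%N.

(* The value 0 for a set of sizes without a maximum only matters for the empty
   set: see [sph_codes_bounded] and [graphs_bounded]. *)
Definition max_size (P : nat -> Prop) : nat := xget 0%N (is_max P).

Lemma max_sizeP (P : nat -> Prop) (B : nat) :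
  (forall m, P m -> (m <= B)%N) -> (exists m, P m) -> is_max P (max_size P).
Proof.
move=> PB [m Pm]; apply: xgetPex.
have ex : exists n, `[< P n >] by exists m; apply/asboolP.
have bd n : `[< P n >] -> (n <= B)%N by move=> /asboolP/PB.
case: (ex_maxnP ex bd) => i /asboolP Pi Hi.
by exists i; split=> // j Pj; apply: Hi; apply/asboolP.
Qed.

Lemma max_size0 (P : nat -> Prop) : (forall m, ~ P m) -> max_size P = 0%N.
Proof. by move=> nP; rewrite /max_size; case: xgetP => // x _ [/nP]. Qed.

(* Finite codes suffice: an infinite code would have finite subcodes of every
   size, contradicting [sph_codes_bounded]. *)
Definition spherical_code (R : realType) (d : nat) (a b : R)
    (S : {fset 'cV[R]_d}) : Prop :=
  (forall x, x \in S -> (x^T *m x) 0 0 = 1) /\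
  (forall x y, x \in S -> y \in S -> x != y ->
     (x^T *m y) 0 0 = a \/ (x^T *m y) 0 0 = b).

Definition sph_code_of_size (R : realType) (a b : R) (d n : nat) : Prop :=
  exists S : {fset 'cV[R]_d}, spherical_code a b S /\ #|` S| = n.

Definition Nsph (R : realType) (a b : R) (d : nat) : nat :=
  max_size (sph_code_of_size a b d).

Definition group_inverse_of (R : realType) (n : nat) (M X : 'M[R]_n) : Prop :=
  [/\ M *m X *m M = M, X *m M *m X = X & M *m X = X *m M].

(* No junk value for symmetric [M]: see [group_inverse_ex] and
   [group_inverse_uniq]. *)
Definition ginv (R : realType) (n : nat) (M : 'M[R]_n) : 'M[R]_n :=
  xget 0 (group_inverse_of M).

Definition is_graph (n : nat) (e : rel 'I_n) : Prop :=
  symmetric e /\ irreflexive e.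

Definition adj (R : realType) (n : nat) (e : rel 'I_n) : 'M[R]_n :=
  \matrix_(i, j) (e i j)%:R.

Definition ones (R : realType) (n : nat) : 'cV[R]_n := const_mx 1.

(* [(u <= A)%MS] is about row spaces, hence the transpositions. *)
Definition in_col_space (R : realType) (m n : nat) (v : 'cV[R]_m)
    (M : 'M[R]_(m, n)) : Prop := (v^T <= M^T)%MS.

(* The [%R] is needed: in the argument of [\rank], [+] would otherwise be the
   sum of row spaces. *)
Definition graph_cond (R : realType) (r : nat) (mu : R) (n : nat)
    (e : rel 'I_n) : Prop :=
  [/\ is_graph e,
      forall l, eigenvalue (adj R e) l -> - mu <= l,
      in_col_space (ones R n) (adj R e + mu%:M) &
      (\rank (adj R e + mu%:M)%R <= r)%N].

Definition ginv_form (R : realType) (mu : R) (n : nat) (e : rel 'I_n) : R :=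
  ((ones R n)^T *m ginv (adj R e + mu%:M) *m ones R n) 0 0.

Definition Nlt (R : realType) (r : nat) (p mu : R) : nat :=
  max_size (fun n =>
    exists e : rel 'I_n, graph_cond r mu e /\ ginv_form mu e < p).

Definition Neq (R : realType) (r : nat) (p mu : R) : nat :=
  max_size (fun n =>
    exists e : rel 'I_n, graph_cond r mu e /\ ginv_form mu e = p).

Definition fmax (R : realType) (alpha beta : R) (d : nat) : nat :=
  let p := (alpha - beta) / (alpha ^+ 2 - beta) in
  let mu := (1 - beta) / (alpha - beta) in
  maxn (Nlt d p mu) (Neq d p mu).

Lemma group_inverse_uniq (R : realType) (n : nat) (M X Y : 'M[R]_n) :
  group_inverse_of M X -> group_inverse_of M Y -> X = Y.
Proof.
move=> [MXM XMX cX] [MYM YMY cY].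
have E : M *m X = M *m Y.
  transitivity (Y *m (M *m X *m M)); last by rewrite MXM cY.
  by rewrite -mulmxA -cX !mulmxA -cY MYM.
by rewrite -XMX -mulmxA E mulmxA -cX E cY YMY.
Qed.

Lemma sqr_sum_eq0 (R : realType) (n : nat) (u : 'rV[R]_n) :
  u *m u^T = 0 -> u = 0.
Proof.
move/matrixP/(_ 0 0); rewrite !mxE => s0.
have s0' : \sum_j u 0 j ^+ 2 = 0.
  by rewrite -[RHS]s0; apply: eq_bigr => j _; rewrite mxE expr2.
apply/rowP => j; rewrite mxE; apply/eqP; rewrite -sqrf_eq0; apply/eqP.
by apply: (psumr_eq0P _ s0') => // k _; rewrite sqr_ge0.
Qed.

Lemma group_inverse_ex (R : realType) (n : nat) (M : 'M[R]_n) :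
  M^T = M -> group_inverse_of M (ginv M).
Proof.
move=> sM; apply: xgetPex.
have [D defM] : exists D, M = D *m (M *m M).
  apply/submxP; rewrite -(geq_leqif (mxrank_leqif_sup (submxMl M M))).
  have : (kermx (M *m M) <= kermx M)%MS.
    apply/rV_subP => v /sub_kermxP vMM; apply/sub_kermxP/sqr_sum_eq0.
    by rewrite trmx_mul sM !mulmxA -(mulmxA v M M) vMM mul0mx.
  by move/mxrankS; rewrite !mxrank_ker leq_sub2lE ?rank_leq_row.
have defM' : M = M *m M *m D^T by rewrite -{1}sM {1}defM !trmx_mul sM.
have DM : D *m M = M *m D^T.
  by rewrite {1}defM' !mulmxA -(mulmxA D) -defM.
have MDM : M *m (D *m M) = M by rewrite DM mulmxA -defM'.
have DMM : D *m M *m M = M by rewrite -mulmxA -defM.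
exists (D *m M *m D^T).
have MX : M *m (D *m M *m D^T) = D *m M by rewrite mulmxA MDM -DM.
have XM : D *m M *m D^T *m M = D *m M.
  have sDM : (D *m M)^T = D *m M by rewrite trmx_mul sM -DM.
  have DtM : M *m D *m M = M by rewrite -mulmxA MDM.
  have MtM : M *m D^T *m M = M by rewrite -DM DMM.
  by rewrite -mulmxA -mulmxA (mulmxA M) MtM.
split; first by rewrite MX DMM.
- by rewrite XM -!mulmxA (mulmxA M D) (mulmxA (M *m D)) -(mulmxA M D) MDM.
- by rewrite MX XM.
Qed.

Lemma adj_sym (R : realType) (n : nat) (mu : R) (e : rel 'I_n) :
  symmetric e -> (adj R e + mu%:M)^T = adj R e + mu%:M.
Proof. by move=> se; apply/matrixP => i j; rewrite !mxE se eq_sym. Qed.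

Lemma rank_hadamard (F : fieldType) (m n : nat) (A B : 'M[F]_(m, n)) :
  (\rank (\matrix_(i, j) (A i j * B i j))%R <= \rank A * \rank B)%N.
Proof.
set a := \rank A; set b := \rank B.
pose W : 'M[F]_(m, a * b) :=
  \matrix_i mxvec (\matrix_(k, l) (col_base A i k * col_base B i l)).
pose Z : 'M[F]_(n, a * b) :=
  \matrix_j mxvec (\matrix_(k, l) (row_base A k j * row_base B l j)).
suff -> : \matrix_(i, j) (A i j * B i j) = W *m Z^T by apply: mulmx_max_rank.
apply/matrixP => i j; rewrite !mxE (reindex _ (curry_mxvec_bij _ _)) /=.
rewrite -{1}(mulmx_base A) -{1}(mulmx_base B) !mxE big_distrlr pair_bigA /=.
by apply: eq_bigr => -[k l] _; rewrite !mxE !mxvecE !mxE mulrACA.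
Qed.

Lemma two_valued_bound (F : fieldType) (n : nat) (G : 'M[F]_n) (a b c : F) :
  c != a -> c != b -> (forall i, G i i = c) ->
  (forall i j, i != j -> G i j = a \/ G i j = b) ->
  (n <= (\rank G).+1 ^ 2)%N.
Proof.
move=> ca cb Gd Go.
have rk (x : F) : (\rank (G - const_mx x)%R <= (\rank G).+1)%N.
  apply: (leq_trans (mxrank_add _ _)); rewrite mxrank_opp -addn1 leq_add2l.
  have -> : (const_mx x : 'M_n) =
      (const_mx x : 'cV_n) *m (const_mx 1 : 'rV_n).
    by apply/matrixP => i j; rewrite !mxE big_ord1 !mxE mulr1.
  exact: mulmx_max_rank.
have := rank_hadamard (G - const_mx a) (G - const_mx b).
have -> : \matrix_(i, j) ((G - const_mx a) i j * (G - const_mx b) i j) =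
    ((c - a) * (c - b))%:M.
  apply/matrixP => i j; rewrite !mxE; have [->|ij] := eqVneq i j.
    by rewrite Gd.
  by case: (Go _ _ ij) => ->; rewrite subrr ?mulr0 ?mul0r.
rewrite -scalemx1 mxrank_scale_nz ?mxrank1 ?mulf_neq0 ?subr_eq0 // => h.
by apply: leq_trans h _; rewrite expnS expn1 leq_mul.
Qed.

Lemma sph_codes_bounded (R : realType) (a b : R) (d n : nat) :
  a < 1 -> b < 1 -> sph_code_of_size a b d n -> (n <= d.+1 ^ 2)%N.
Proof.
move=> a1 b1 [S [[Su So] <-]].
pose x (i : 'I_#|` S|) : 'cV[R]_d := nth 0 S i.
have xS i : x i \in S by apply: mem_nth.
pose X : 'M[R]_(d, #|` S|) := \matrix_(k, i) x i k 0.
have XE i j : (X^T *m X) i j = ((x i)^T *m x j) 0 0.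
  by rewrite !mxE; apply: eq_bigr => k _; rewrite !mxE.
apply: (leq_trans (@two_valued_bound _ _ (X^T *m X) a b 1 _ _ _ _)).
- by rewrite gt_eqF.
- by rewrite gt_eqF.
- by move=> i; rewrite XE Su.
- move=> i j ij; rewrite XE; apply: So => //.
  by rewrite nth_uniq // fset_uniq.
- by rewrite leq_exp2r // ltnS mulmx_max_rank.
Qed.

Lemma graphs_bounded (R : realType) (r n : nat) (mu : R) (e : rel 'I_n) :
  1 < mu -> graph_cond r mu e -> (n <= r.+1 ^ 2)%N.
Proof.
move=> mu1 [[_ ie] _ _ rk].
apply: (leq_trans (@two_valued_bound _ _ (adj R e + mu%:M) 0 1 mu _ _ _ _)).
- by rewrite gt_eqF // (lt_trans ltr01).
- by rewrite gt_eqF.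
- by move=> i; rewrite !mxE ie eqxx mulr1n add0r.
- move=> i j ij; rewrite !mxE (negbTE ij) mulr0n addr0.
  by case: (e i j); [right|left].
- by rewrite leq_exp2r //.
Qed.

(* Main.v *)
(* Let A be the adjacency matrix of a graph and M = A + mu I with
   mu = (1 - beta) / (alpha - beta).  For a, b > 0, the matrix a M - b J is
   positive semidefinite iff M is, j lies in R(M), and j^T M^# j <= a / b.
   The choice a = alpha - beta, b = alpha^2 - beta gives, up to the factor
   1 - alpha^2, the Gram matrices of {alpha0, beta0}-codes, so every graph
   counted by f yields such a code of the same size.  Conversely, in an
   {alpha, beta}-code the vectors having inner product alpha with x,
   projected onto the hyperplane orthogonal to x, have such a Gram
   matrix of rank < d; so every degree is at most f.  Evaluating the Gram matrix
   of the whole code at j then bounds its size. *)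
Require Import Defs.
From HB Require Import structures.
From mathcomp Require Import all_boot all_order all_algebra finmap.
From mathcomp Require Import boolp classical_sets reals.
From mathcomp Require Import ring lra complex.

Set Implicit Arguments.
Unset Strict Implicit.
Unset Printing Implicit Defensive.

Import Order.TTheory GRing.Theory Num.Theory.
Local Open Scope ring_scope.

(** * Maximal sizes of bounded families *)

Lemma max_size_leq (P : nat -> Prop) (B : nat) :
  (forall m, P m -> (m <= B)%N) -> (max_size P <= B)%N.
Proof. by move=> PB; rewrite /max_size; case: xgetP => // x _ [/PB]. Qed.

Lemma leq_max_size (P : nat -> Prop) (B m : nat) :
  (forall k, P k -> (k <= B)%N) -> P m -> (m <= max_size P)%N.
Proof. by move=> PB Pm; have [_] := max_sizeP PB (ex_intro _ m Pm); apply. Qed.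

(** * Positive semidefinite forms and Gram factorizations *)

Definition bilform (R : realType) (n : nat) (M : 'M[R]_n) (u v : 'cV[R]_n) : R :=
  (u^T *m M *m v) 0 0.

Definition psd (R : realType) (n : nat) (M : 'M[R]_n) : Prop :=
  forall v, 0 <= bilform M v v.

Lemma bilform_sym (R : realType) (n : nat) (M : 'M[R]_n) (u v : 'cV[R]_n) :
  M^T = M -> bilform M u v = bilform M v u.
Proof.
move=> sM; rewrite /bilform -[in LHS](trmxK (u^T *m M *m v)) mxE.
by rewrite !trmx_mul trmxK sM mulmxA.
Qed.

Lemma bilform_lincomb (R : realType) (n : nat) (M : 'M[R]_n) (u v : 'cV[R]_n)
    (s t : R) :
  M^T = M ->
  bilform M (s *: u + t *: v) (s *: u + t *: v) =
  s ^+ 2 * bilform M u u + s * t * bilform M u v *+ 2 + t ^+ 2 * bilform M v v.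
Proof.
move=> sM; have := bilform_sym u v sM; rewrite /bilform.
have -> : (s *: u + t *: v)^T = s *: u^T + t *: v^T.
  by rewrite linearD !linearZ.
rewrite !(mulmxDl, mulmxDr, =^~ scalemxAl, =^~ scalemxAr).
move: (u^T *m M *m u) (u^T *m M *m v) (v^T *m M *m u) (v^T *m M *m v).
by move=> A B C D; rewrite !mxE => ->; ring.
Qed.

Lemma psd_CauchySchwarz (R : realType) (n : nat) (M : 'M[R]_n)
    (u v : 'cV[R]_n) :
  M^T = M -> psd M -> bilform M u v ^+ 2 <= bilform M u u * bilform M v v.
Proof.
move=> sM pM; have lc s t := bilform_lincomb u v s t sM.
have nn s t : 0 <= s ^+ 2 * bilform M u u + s * t * bilform M u v *+ 2
    + t ^+ 2 * bilform M v v by rewrite -lc.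
have := pM v; rewrite le_eqVlt => /orP[/eqP v0|v_gt0].
  rewrite -v0 mulr0; have [-> | uv] := eqVneq (bilform M u v) 0.
    by rewrite expr0n.
  (* As [bilform M v v = 0], the form is affine in [t] along [u + t v]; this [t] gives it the value
     -1, a contradiction. *)
  have := nn 1 (- (bilform M u u + 1) / (bilform M u v *+ 2)).
  rewrite -v0 mulr0 addr0.
  suff -> : 1 ^+ 2 * bilform M u u +
    1 * (- (bilform M u u + 1) / (bilform M u v *+ 2)) * bilform M u v *+ 2 = -1.
    by rewrite oppr_ge0 ler10.
  by field.
have := nn (bilform M v v) (- bilform M u v).
suff -> : bilform M v v ^+ 2 * bilform M u u +
    bilform M v v * - bilform M u v * bilform M u v *+ 2 +
    (- bilform M u v) ^+ 2 * bilform M v v =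
    bilform M v v * (bilform M u u * bilform M v v - bilform M u v ^+ 2).
  by rewrite pmulr_rge0 // subr_ge0.
by ring.
Qed.

Lemma psd_gram (R : realType) (d n : nat) (X : 'M[R]_(d, n)) : psd (X^T *m X).
Proof.
move=> v; rewrite /bilform !mulmxA -trmx_mul -mulmxA mxE sumr_ge0 // => k _.
by rewrite mxE -expr2 sqr_ge0.
Qed.

Lemma bilformE (R : realType) (n : nat) (M : 'M[R]_n) (i j : 'I_n) :
  bilform M (delta_mx i 0) (delta_mx j 0) = M i j.
Proof. by rewrite /bilform trmx_delta -mulmxA -colE -rowE !mxE. Qed.

Lemma psd_diag0 (R : realType) (n : nat) (M : 'M[R]_n) :
  M^T = M -> psd M -> (forall i, M i i = 0) -> M = 0.
Proof.
move=> sM pM M0; apply/matrixP => i j; rewrite mxE; apply/eqP.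
have := psd_CauchySchwarz (delta_mx i 0) (delta_mx j 0) sM pM.
by rewrite !bilformE !M0 mulr0 -[_ == 0]sqrf_eq0 eq_le sqr_ge0 andbT.
Qed.

(* Cholesky with pivoting: subtracting the rank-one matrix of a column with
   nonzero diagonal entry keeps the matrix positive semidefinite and lowers
   the rank. *)
Lemma psd_is_gram (R : realType) (d n : nat) (M : 'M[R]_n) :
  M^T = M -> psd M -> (\rank M <= d)%N -> exists X : 'M[R]_(d, n), M = X^T *m X.
Proof.
elim: d M => [|d IHd] M sM pM rM.
  exists 0; move: rM; rewrite leqn0 mxrank_eq0 => /eqP ->.
  by rewrite mulmx0.
have [i Mi0 | M0] := pickP (fun i => M i i != 0); last first.
  exists 0; rewrite mulmx0; apply: psd_diag0 => // i.
  by apply/eqP; rewrite -[_ == _]negbK M0.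
have Mi : 0 < M i i by rewrite lt_def Mi0 -(bilformE M) pM.
pose e : 'cV[R]_n := delta_mx i 0.
pose u : 'rV[R]_n := (Num.sqrt (M i i))^-1 *: (e^T *m M).
pose M' := M - u^T *m u.
have uu : u^T *m u = (M i i)^-1 *: (M *m e *m (e^T *m M)).
  have -> : u^T = (Num.sqrt (M i i))^-1 *: (M *m e).
    by rewrite linearZ /= trmx_mul trmxK sM.
  rewrite -scalemxAl -scalemxAr scalerA.
  by rewrite -expr2 exprVn sqr_sqrtr ?ltW.
have sM' : M'^T = M' by rewrite linearB /= trmx_mul trmxK sM.
have fM' v : bilform M' v v = bilform M v v - (M i i)^-1 * bilform M v e ^+ 2.
  rewrite {1}/bilform mulmxBr mulmxBl uu -scalemxAr -scalemxAl.
  rewrite [LHS]mxE [X in _ + X]mxE [X in _ - X]mxE; congr (_ - _ * _).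
  rewrite expr2 -{2}(bilform_sym e v sM) /bilform !mulmxA -!(mulmxA (v^T *m M *m e)).
  by rewrite [LHS]mxE big_ord1.
have pM' : psd M'.
  move=> v; rewrite fM' subr_ge0 mulrC ler_pdivrMr //.
  by apply: le_trans (psd_CauchySchwarz v e sM pM) _; rewrite bilformE.
have Me : M' *m e = 0.
  rewrite mulmxBl uu -scalemxAl -!mulmxA (mulmxA e^T).
  have -> : e^T *m M *m e = (M i i)%:M.
    by apply/matrixP => x y; rewrite !ord1 -/(bilform M e e) bilformE mxE.
  by rewrite mul_mx_scalar -scalemxAr scalerA mulVf // scale1r subrr.
have sub : (M' <= M)%MS.
  by rewrite addmx_sub // eqmx_opp uu scalemx_sub // mulmxA submxMl.
(* [M'] kills [e] but [M] does not, as [M i i] is nonzero; so the row space shrinks strictly. *)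
have lt : (M' < M)%MS.
  rewrite ltmxE sub; apply/negP => /submxP[D MD]; move: Mi0.
  by rewrite -(bilformE M) /bilform -mulmxA -/e MD -[D *m M' *m e]mulmxA Me !mulmx0 mxE eqxx.
have [X M'X] := IHd M' sM' pM' (leq_trans (rank_ltmx lt) rM).
suff : M = (col_mx u X)^T *m col_mx u X by exists (col_mx u X).
by rewrite tr_col_mx mul_row_col -M'X /M' addrC subrK.
Qed.

(** * Eigenvalue bounds as semidefiniteness *)

(** The spectral theorem for the complexification [B] of [A] turns the form into the sum of the
    [(D_i - c) |u_i|^2], where the [D_i] are real eigenvalues of [A]. *)
Lemma eigenvalue_ge_psd (R : realType) (n : nat) (A : 'M[R]_n) (c : R) :
  A^T = A -> (forall l, eigenvalue A l -> c <= l) -> psd (A - c%:M).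
Proof.
move=> sA Ac v; pose f := real_complex R; pose B := map_mx f A.
have hB : B \is hermsymmx.
  apply: realsym_hermsym.
    apply/is_hermitianmxP; rewrite expr0 scale1r /B map_mx_id //.
    by apply/matrixP => i j; rewrite !mxE -{1}sA mxE.
  by apply/mxOverP => i j; rewrite mxE complex_real.
pose P := spectralmx B; pose D := spectral_diag B.
have Pu : P \is unitarymx := spectral_unitarymx B.
have iP : invmx P = (P ^t*)%sesqui := invmx_unitary Pu.
have BE : B = invmx P *m diag_mx D *m P.
  exact/orthomx_spectralP/hermitian_normalmx.
have DE i : f (complex.Re (D 0 i)) = D 0 i.
  by apply: RRe_real; move/mxOverP: (hermitian_spectral_diag_real hB); apply.
(* Being a root of the characteristic polynomial transfers along [f], so it suffices that row [i] of
   [P] is an eigenvector of [B]. *)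
have eD i : eigenvalue A (complex.Re (D 0 i)).
  rewrite eigenvalue_root_char -(fmorph_root f) map_char_poly -/B.
  rewrite -eigenvalue_root_char; apply/eigenvalueP; exists (row i P).
    rewrite -row_mul BE !mulmxA mulmxV ?spectral_unit // mul1mx mul_diag_mx.
    by apply/rowP => j; rewrite !mxE -[in LHS]DE.
  apply: contraTneq (spectral_unit B) => Pi0.
  by rewrite -row_free_unit; apply/row_freePn; exists i; rewrite -/P Pi0 sub0mx.
pose u := P *m map_mx f v.
have uE : (map_mx f v)^T *m invmx P = (u ^t*)%sesqui.
  rewrite iP /u trmx_mul map_mxM; congr (_ *m _).
  apply/matrixP => i j; rewrite !mxE.
  by apply/esym/conj_Creal; rewrite complex_real.
have BcE : map_mx f (A - c%:M) = invmx P *m diag_mx (D - const_mx (f c)) *m P.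
  rewrite map_mxB map_scalar_mx -/B BE linearB /= diag_const_mx mulmxBr mulmxBl.
  by rewrite mul_mx_scalar -scalemxAl mulVmx ?spectral_unit // scalemx1.
suff : 0 <= f (bilform (A - c%:M) v v) by rewrite ler0c.
have -> : f (bilform (A - c%:M) v v) =
    ((u ^t*)%sesqui *m (diag_mx (D - const_mx (f c)) *m u)) 0 0.
  have -> : f (bilform (A - c%:M) v v) = map_mx f (v^T *m (A - c%:M) *m v) 0 0.
    by rewrite [RHS]mxE.
  by rewrite !map_mxM /= BcE -uE /u -map_trmx !mulmxA.
rewrite mul_diag_mx mxE sumr_ge0 // => i _; rewrite !mxE mulrCA mulr_ge0 //.
  by rewrite -DE -[in f c]/f -rmorphB /= ler0c subr_ge0 Ac.
by rewrite mulrC mul_conjC_ge0.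
Qed.

Lemma psd_eigenvalue_ge (R : realType) (n : nat) (A : 'M[R]_n) (c l : R) :
  psd (A - c%:M) -> eigenvalue A l -> c <= l.
Proof.
move=> pA /eigenvalueP[v vA v0]; have := pA v^T.
rewrite /bilform trmxK mulmxBr vA mul_mx_scalar -scalerBl -scalemxAl mxE.
have vv : 0 < (v *m v^T) 0 0.
  rewrite lt_def; apply/andP; split.
    apply: contra v0 => /eqP v0; apply/eqP/sqr_sum_eq0/matrixP => i j.
    by rewrite !ord1 v0 mxE.
  by rewrite mxE sumr_ge0 // => k _; rewrite mxE -expr2 sqr_ge0.
by rewrite pmulr_lge0 // subr_ge0.
Qed.

(** * The group inverse and the matrices [a M - b J] *)

(** Trades the group inverse for a solution of a linear system: [w = M^# u] works because
    [M M^# M = M] and [u] lies in the column space. *)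
Lemma ginv_preimage (R : realType) (n : nat) (M : 'M[R]_n) (u : 'cV[R]_n) :
  M^T = M -> in_col_space u M ->
  exists2 w, M *m w = u & u^T *m ginv M *m u = u^T *m w.
Proof.
move=> sM /submxP[D uD]; have [MXM _ _] := group_inverse_ex sM.
have -> : u = M *m D^T by rewrite -[LHS]trmxK uD trmx_mul !trmxK.
by exists (ginv M *m (M *m D^T)); rewrite !mulmxA ?MXM.
Qed.

Lemma trmx00 (R : realType) (A : 'M[R]_1) : A^T 0 0 = A 0 0.
Proof. by rewrite mxE. Qed.

Lemma bilform_ones (R : realType) (n : nat) (M : 'M[R]_n) (a b : R)
    (u v : 'cV[R]_n) :
  bilform (a *: M - b *: (ones R n *m (ones R n)^T)) u v =
  a * bilform M u v - b * ((u^T *m ones R n) 0 0 * (v^T *m ones R n) 0 0).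
Proof.
rewrite /bilform mulmxBr mulmxBl -!(scalemxAl, scalemxAr).
rewrite [LHS]mxE [X in _ + X]mxE [X in X + _]mxE [X in _ - X]mxE.
congr (_ - _ * _); rewrite mulmxA -(mulmxA _ _ v) [LHS]mxE big_ord1; congr (_ * _).
by rewrite -[RHS]trmx00 trmx_mul trmxK.
Qed.

(** On a kernel vector [v] of [M] the form is [- b (j^T v)^2], so [j] is orthogonal to the kernel of
    the symmetric matrix [M]. *)
Lemma ones_in_col_space (R : realType) (n : nat) (M : 'M[R]_n) (a b : R) :
  M^T = M -> 0 < b ->
  psd (a *: M - b *: (ones R n *m (ones R n)^T)) -> in_col_space (ones R n) M.
Proof.
move=> sM b_gt0 pQ; rewrite /in_col_space sM submxE; apply/eqP/matrixP => i k.
rewrite ord1 [RHS]mxE; pose v := cokermx M *m delta_mx k (0 : 'I_1).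
have Mv : M *m v = 0 by rewrite mulmxA mulmx_coker mul0mx.
have -> : ((ones R n)^T *m cokermx M) 0 k = (v^T *m ones R n) 0 0.
  by rewrite -[RHS]trmx00 trmx_mul trmxK /v (mulmxA _ (cokermx M)) -colE [RHS]mxE.
have := pQ v; rewrite bilform_ones {1}/bilform -mulmxA Mv mulmx0 mxE mulr0 sub0r.
rewrite -expr2 oppr_ge0 pmulr_rle0 // => h; apply/eqP.
by rewrite -sqrf_eq0 eq_le h sqr_ge0.
Qed.

(* The vector [w] with [M w = j] has [w^T M w = w^T j = j^T M^# j], so testing
   [a M - b J] on it compares [j^T M^# j] with its square. *)
Lemma ginv_ones_le (R : realType) (n : nat) (M : 'M[R]_n) (a b : R) :
  M^T = M -> 0 < a -> 0 < b ->
  psd (a *: M - b *: (ones R n *m (ones R n)^T)) ->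
  ((ones R n)^T *m ginv M *m ones R n) 0 0 <= a / b.
Proof.
move=> sM a_gt0 b_gt0 pQ.
have [w Mw ->] := ginv_preimage sM (ones_in_col_space sM b_gt0 pQ).
have -> : ((ones R n)^T *m w) 0 0 = (w^T *m ones R n) 0 0.
  by rewrite -[RHS]trmx00 trmx_mul trmxK.
have := pQ w; rewrite bilform_ones {1}/bilform -mulmxA Mw.
set s := (_ *m _) 0 0; rewrite ler_pdivlMr // => h.
have [s_le0|s_gt0] := leP s 0.
  by rewrite (le_trans _ (ltW a_gt0)) // pmulr_lle0.
by rewrite -subr_ge0 -(pmulr_lge0 _ s_gt0) mulrBl (mulrC s b) -mulrA.
Qed.

(** With [M w = j], Cauchy-Schwarz gives [(j^T v)^2 <= (v^T M v) (w^T M w)], and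
    [w^T M w = j^T M^# j]. *)
Lemma psd_of_ginv_ones_le (R : realType) (n : nat) (M : 'M[R]_n) (a b : R) :
  M^T = M -> psd M -> 0 < b -> in_col_space (ones R n) M ->
  ((ones R n)^T *m ginv M *m ones R n) 0 0 <= a / b ->
  psd (a *: M - b *: (ones R n *m (ones R n)^T)).
Proof.
move=> sM pM b_gt0 jM; have [w Mw ->] := ginv_preimage sM jM.
have -> : ((ones R n)^T *m w) 0 0 = bilform M w w.
  by rewrite /bilform -mulmxA Mw -[RHS]trmx00 trmx_mul trmxK.
rewrite ler_pdivlMr // => sab v; rewrite bilform_ones.
have := psd_CauchySchwarz v w sM pM.
rewrite {1}/bilform -mulmxA Mw -expr2 => CS; rewrite subr_ge0.
apply: (@le_trans _ _ (b * (bilform M v v * bilform M w w))).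
  by rewrite ler_pM2l.
by rewrite mulrCA mulrC ler_wpM2r ?pM // mulrC.
Qed.

(** * Codes as Gram matrices, and the graphs they define *)

Definition gram_code (R : realType) (a b : R) (d n : nat)
    (X : 'M[R]_(d, n)) : Prop :=
  (forall i, (X^T *m X) i i = 1) /\
  (forall i j, i != j -> (X^T *m X) i j = a \/ (X^T *m X) i j = b).

Lemma gram_codeP (R : realType) (a b : R) (d n : nat) :
  a < 1 -> b < 1 ->
  sph_code_of_size a b d n <-> exists X : 'M[R]_(d, n), gram_code a b X.
Proof.
move=> a1 b1; split=> [[S [[Su So] <-]]|[X [Xu Xo]]].
  pose x (i : 'I_#|` S|) : 'cV[R]_d := nth 0 S i.
  have xS i : x i \in S by apply: mem_nth.
  exists (\matrix_(k, i) x i k 0); set X := \matrix_(k, i) _.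
  have XE i j : (X^T *m X) i j = ((x i)^T *m x j) 0 0.
    by rewrite !mxE; apply: eq_bigr => k _; rewrite !mxE.
  split=> [i|i j ij]; first by rewrite XE Su.
  by rewrite XE; apply: So => //; rewrite nth_uniq // fset_uniq.
have XE i j : ((col i X)^T *m col j X) 0 0 = (X^T *m X) i j.
  by rewrite !mxE; apply: eq_bigr => k _; rewrite !mxE.
(* Equal columns would have inner product 1, which is neither [a] nor [b]. *)
have Xinj : injective (fun i => col i X).
  move=> i j eq_ij; apply/eqP/negPn/negP => /Xo.
  by rewrite -XE eq_ij XE Xu => -[] h; move: a1 b1; rewrite -h ltxx.
exists [fset col i X | i in 'I_n]%fset; split; last first.
  by rewrite card_imfset //= -cardE card_ord.
split=> [_ /imfsetP[i _ ->]|_ _ /imfsetP[i _ ->] /imfsetP[j _ ->] ij].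
  by rewrite XE.
by rewrite XE; apply: Xo; apply: contraNneq ij => ->.
Qed.

(** Since [a M = Y^T Y + b J], [M] is positive semidefinite; the strict bound on the rank of [Y]
    leaves room for the rank-one [J]. *)
Lemma graph_of_gram (R : realType) (d n : nat) (a b mu : R) (e : rel 'I_n)
    (Y : 'M[R]_(d, n)) :
  is_graph e -> 0 < a -> 0 < b -> (\rank Y < d)%N ->
  Y^T *m Y = a *: (adj R e + mu%:M) - b *: (ones R n *m (ones R n)^T) ->
  graph_cond d mu e /\ ginv_form mu e <= a / b.
Proof.
move=> ge a_gt0 b_gt0 rY; set M := adj R e + mu%:M; set J := ones R n *m _ => YE.
have sM : M^T = M by case: ge => se _; exact: adj_sym.
have pQ : psd (a *: M - b *: J) by rewrite -YE; exact: psd_gram.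
have ME : M = a^-1 *: (Y^T *m Y + b *: J).
  by rewrite YE subrK scalerA mulVf ?gt_eqF // scale1r.
split; last exact: ginv_ones_le pQ.
split=> //; last 2 first.
- exact: ones_in_col_space pQ.
- rewrite -/M ME (leq_trans (mxrankS (scalemx_sub _ (submx_refl _)))) //.
  apply: leq_trans (mxrank_add _ _) (leq_trans _ rY); rewrite -addn1 leq_add //.
    exact: mxrankM_maxr.
  by rewrite (leq_trans (mxrankS (scalemx_sub _ (submx_refl _)))) // mulmx_max_rank.
move=> l; apply: psd_eigenvalue_ge => v; rewrite raddfN opprK -/M.
rewrite -(pmulr_rge0 _ a_gt0); have := pQ v; rewrite bilform_ones subr_ge0.
by apply: le_trans; rewrite -expr2 mulr_ge0 ?sqr_ge0 ?ltW.
Qed.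

Lemma mu_gt1 (R : realType) (alpha beta : R) :
  beta < alpha -> alpha < 1 -> 1 < (1 - beta) / (alpha - beta).
Proof. by move=> ba a1; rewrite ltr_pdivlMr ?subr_gt0 // mul1r ltrD2r. Qed.

(** Equality is counted by [Neq], strict inequality by [Nlt]; boundedness by [d.+1 ^ 2] makes both
    maxima attained. *)
Lemma leq_fmax (R : realType) (alpha beta : R) (d n : nat) (e : rel 'I_n) :
  beta < alpha -> alpha < 1 ->
  let mu := (1 - beta) / (alpha - beta) in
  graph_cond d mu e ->
  ginv_form mu e <= (alpha - beta) / (alpha ^+ 2 - beta) ->
  (n <= fmax alpha beta d)%N.
Proof.
move=> ba a1 mu ge; have mu1 : 1 < mu := mu_gt1 ba a1.
rewrite /fmax -/mu leq_max le_eqVlt => /orP[/eqP s_eq|s_lt]; apply/orP.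
  by right; apply: (@leq_max_size _ (d.+1 ^ 2)) => [k [f [gf _]]|];
    [exact: graphs_bounded gf | exists e].
by left; apply: (@leq_max_size _ (d.+1 ^ 2)) => [k [f [gf _]]|];
  [exact: graphs_bounded gf | exists e].
Qed.

Lemma fmax_leq (R : realType) (alpha beta : R) (d B : nat) :
  (forall n (e : rel 'I_n), let mu := (1 - beta) / (alpha - beta) in
     graph_cond d mu e ->
     ginv_form mu e <= (alpha - beta) / (alpha ^+ 2 - beta) -> (n <= B)%N) ->
  (fmax alpha beta d <= B)%N.
Proof.
move=> nB; rewrite /fmax geq_max; apply/andP; split; apply: max_size_leq.
  by move=> n [e [ge /ltW]]; exact: nB.
by move=> n [e [ge s_eq]]; apply: nB ge _; rewrite s_eq.
Qed.

(* Subtracting from each neighbour [x_j] its component [alpha x_i] along [x_i]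
   leaves vectors in a hyperplane whose Gram matrix is a combination of [A + mu I]
   and [J]. *)
Lemma max_degree_le_fmax (R : realType) (alpha beta : R) (d n : nat)
    (X : 'M[R]_(d, n)) (i : 'I_n) :
  beta < alpha -> alpha < 1 -> beta < 0 -> gram_code alpha beta X ->
  (#|[set j | (j != i) && ((X^T *m X) i j == alpha)]| <= fmax alpha beta d)%N.
Proof.
move=> ba a1 b0 [Xu Xo]; set N := [set j | _]; set G := X^T *m X in Xu Xo N *.
have sG k l : G k l = G l k.
  by rewrite !mxE; apply: eq_bigr => p _; rewrite !mxE mulrC.
pose g (k : 'I_#|N|) : 'I_n := enum_val k.
have gN k : G i (g k) = alpha.
  by have := enum_valP k; rewrite inE => /andP[_ /eqP].
pose e : rel 'I_#|N| := [rel k l | (k != l) && (G (g k) (g l) == alpha)].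
pose Y := \matrix_(p < d, k < #|N|) (X p (g k) - alpha * X p i).
have YE k l : (Y^T *m Y) k l = G (g k) (g l) - alpha ^+ 2.
  (* The right side expands the inner product of [x_k - alpha x_i] and [x_l - alpha x_i]. *)
  have -> : G (g k) (g l) - alpha ^+ 2 = G (g k) (g l) - alpha * G i (g k)
      - alpha * G i (g l) + alpha ^+ 2 * G i i.
    by rewrite !gN Xu; ring.
  rewrite !mxE !mulr_sumr -!sumrB -big_split /=; apply: eq_bigr => p _.
  by rewrite !mxE; ring.
have ge : is_graph e.
  by split=> [k l|k]; rewrite /e /= ?eqxx // sG eq_sym.
have [| | | |] := @graph_of_gram R d #|N| (alpha - beta) (alpha ^+ 2 - beta)
    ((1 - beta) / (alpha - beta)) e Y ge.
- by rewrite subr_gt0.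
- by rewrite subr_gt0 (lt_le_trans b0) ?sqr_ge0.
(* The columns of [Y] are orthogonal to the unit vector [x_i], hence the rank is below [d]. *)
- have : (col i X)^T *m Y = 0.
    apply/matrixP => z k; rewrite !ord1 [RHS]mxE.
    transitivity (G i (g k) - alpha * G i i); last by rewrite gN Xu mulr1 subrr.
    rewrite !mxE mulr_sumr -sumrB; apply: eq_bigr => p _.
    by rewrite !mxE; ring.
  move/mulmx0_rank_max; apply: leq_trans; rewrite -add1n leq_add2r lt0n mxrank_eq0.
  apply: contraTneq (oner_neq0 R) => x0.
  by rewrite negbK -(Xu i) [G i i]mxE big1 // => p _;
    rewrite !mxE; have /matrixP/(_ 0 p) := x0; rewrite !mxE => ->; rewrite mul0r.
(* The value of [mu] is the one giving diagonal [(alpha - beta) mu - (alpha^2 - beta) = 1 -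
   alpha^2]. *)
- apply/matrixP => k l; rewrite YE; set x := G _ _.
  rewrite !mxE big_ord1 !mxE !mulr1 /e /= -/x {}/x.
  have ab0 : alpha - beta != 0 by rewrite subr_eq0 gt_eqF.
  have [->|kl] /= := eqVneq k l.
    by rewrite Xu; field.
  have /Xo[->|->] : g k != g l by rewrite (inj_eq enum_val_inj).
    by rewrite eqxx mulr0n mulr1n; ring.
  by rewrite (lt_eqF ba) !mulr0n; ring.
exact: leq_fmax.
Qed.

(** * The two inequalities *)

Lemma fmax_le_Nsph (R : realType) (alpha beta : R) (d : nat) :
  -1 < alpha -> beta < alpha -> alpha < 1 -> beta < 0 ->
  (fmax alpha beta d <=
     Nsph (alpha / (1 + alpha)) ((beta - alpha ^+ 2) / (1 - alpha ^+ 2)) d)%N.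
Proof.
move=> aN1 ba a1 b0; apply: fmax_leq => n e mu [ge ev jM rM] s_le.
have sM : (adj R e + mu%:M)^T = adj R e + mu%:M.
  by apply: adj_sym; case: ge.
have sA : (adj R e)^T = adj R e.
  by apply/matrixP => k l; rewrite !mxE; case: ge => ->.
have pM : psd (adj R e + mu%:M).
  have -> : adj R e + mu%:M = adj R e - (- mu)%:M by rewrite raddfN opprK.
  exact: eigenvalue_ge_psd.
have p_gt0 : 0 < alpha ^+ 2 - beta by rewrite subr_gt0 (lt_le_trans b0) ?sqr_ge0.
have a2_gt0 : 0 < 1 - alpha ^+ 2 by nra.
have pQ := psd_of_ginv_ones_le sM pM p_gt0 jM s_le.
set M := adj R e + mu%:M in sM pM jM rM pQ.
set Q := _ - _ in pQ.
have sQ : Q^T = Q.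
  rewrite /Q linearB !linearZ /= sM trmx_mul trmxK; reflexivity.
(* [j] lies in the row space of [M], so subtracting a multiple of [J] does not raise the rank. *)
have rQ : (\rank Q <= d)%N.
  apply: leq_trans rM; apply: mxrankS; rewrite addmx_sub ?scalemx_sub //.
  rewrite eqmx_opp scalemx_sub // mulmx_sub //.
  by move: jM; rewrite /in_col_space sM.
have [X QX] := psd_is_gram sQ pQ rQ.
(* [Q] has diagonal [1 - alpha^2], so scaling by [c] gives unit vectors. *)
pose c := (Num.sqrt (1 - alpha ^+ 2))^-1.
have GE k l : ((c *: X)^T *m (c *: X)) k l = (1 - alpha ^+ 2)^-1 *
    ((alpha - beta) * ((e k l)%:R + mu *+ (k == l)) - (alpha ^+ 2 - beta)).
  have -> : (c *: X)^T *m (c *: X) = (1 - alpha ^+ 2)^-1 *: Q.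
    have -> : (c *: X)^T = c *: X^T by rewrite linearZ.
    rewrite -scalemxAl -scalemxAr scalerA -QX -expr2 exprVn.
    by rewrite sqr_sqrtr ?ltW.
  by rewrite !mxE big_ord1 !mxE !mulr1.
have ab0 : alpha - beta != 0 by rewrite subr_eq0 gt_eqF.
have ap0 : 1 + alpha != 0 by apply: lt0r_neq0; lra.
have am0 : 1 - alpha ^+ 2 != 0 by rewrite gt_eqF.
apply: (@leq_max_size _ (d.+1 ^ 2)) => [m|].
  apply: sph_codes_bounded; first by rewrite ltr_pdivrMr; lra.
  by rewrite ltr_pdivrMr // mul1r; lra.
apply/gram_codeP.
- by rewrite ltr_pdivrMr; lra.
- by rewrite ltr_pdivrMr // mul1r; lra.
exists (c *: X); split=> [k|k l kl]; rewrite GE.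
  by case: ge => _ ->; rewrite eqxx mulr0n mulr1n /mu; field; rewrite ab0.
rewrite (negbTE kl) mulr0n addr0; case: (e k l); [left|right].
  by rewrite mulr1n; field; rewrite ap0.
by rewrite mulr0n; field.
Qed.

Lemma gram_code_le (R : realType) (alpha beta : R) (d n : nat)
    (X : 'M[R]_(d, n)) (D : R) :
  beta < alpha -> alpha < 1 -> beta < 0 -> gram_code alpha beta X ->
  0 <= D -> (forall i,
    #|[set j | (j != i) && ((X^T *m X) i j == alpha)]|%:R <= D) ->
  n%:R <= (alpha - beta) / (- beta) * (D + (1 - beta) / (alpha - beta)).
Proof.
move=> ba a1 b0 [Xu Xo] D_ge0 degD; set G := X^T *m X in Xu Xo degD.
have rowE i : \sum_j G i j = (alpha - beta) *
    #|[set j | (j != i) && (G i j == alpha)]|%:R + (1 - beta) + beta * n%:R.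
  (* Each entry is [beta], corrected by [alpha - beta] at the [alpha]-entries off the diagonal and
     by [1 - beta] on the diagonal. *)
  pose h j := (alpha - beta) * ((j != i) && (G i j == alpha))%:R +
    ((1 - beta) * (j == i)%:R + beta).
  rewrite (eq_bigr h) => [|j _]; last first.
    rewrite /h; have [->|ji] /= := eqVneq j i.
      by rewrite Xu mulr0n mulr1n; ring.
    have /Xo[->|->] : i != j by rewrite eq_sym.
      by rewrite eqxx mulr0n mulr1n; ring.
    by rewrite (lt_eqF ba) !mulr0n; ring.
  rewrite !big_split /= -!mulr_sumr sumr_const card_ord -[beta *+ n]mulr_natr addrA.
  congr (_ * _ + _ + _).
    rewrite -natr_sum -sum1dep_card [in RHS]big_mkcond /=; congr (_ *+ _).
  by rewrite (bigD1 i) //= eqxx big1 ?addr0 ?mulr1 // => j /negbTE ->.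
have sum_ge0 : 0 <= \sum_i \sum_j G i j.
  have := psd_gram X (ones R n); rewrite /bilform -/G -mulmxA mxE.
  congr (0 <= _); apply: eq_bigr => i _; rewrite !mxE mul1r.
  by apply: eq_bigr => j _; rewrite [ones _ _ _ _]mxE mulr1.
(* The empty code is set apart because the inequality for [j^T G j] is divided by [n] below. *)
have [n0|n_gt0] := posnP n.
  by rewrite n0 mulr_ge0 // ?addr_ge0 // divr_ge0 //; lra.
have ab_gt0 : 0 < alpha - beta by rewrite subr_gt0.
have : 0 <= n%:R * ((alpha - beta) * D + (1 - beta) + beta * n%:R).
  apply: le_trans sum_ge0 _.
  rewrite mulr_natl -[n in _ *+ n]card_ord -sumr_const ler_sum // => i _.
  by rewrite rowE !lerD2r ler_pM2l.
rewrite pmulr_rge0 ?ltr0n // => h.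
have -> : (alpha - beta) / - beta * (D + (1 - beta) / (alpha - beta)) =
    ((alpha - beta) * D + (1 - beta)) / - beta.
  by field; rewrite (lt_eqF b0) gt_eqF.
by rewrite ler_pdivlMr ?oppr_gt0 //; lra.
Qed.

Theorem theorem5p2 (R : realType) (d : nat) (alpha beta : R)
    (d_gt0 : (0 < d)%N) (beta_ge : -1 <= beta) (beta_lt : beta < alpha)
    (alpha_lt1 : alpha < 1) (beta_lt0 : beta < 0) :
  let f := fmax alpha beta d in
  let alpha0 := alpha / (1 + alpha) in
  let beta0 := (beta - alpha ^+ 2) / (1 - alpha ^+ 2) in
  (Nsph alpha beta d)%:R <=
    (alpha - beta) / (- beta) * (f%:R + (1 - beta) / (alpha - beta))
  /\ (f <= Nsph alpha0 beta0 d)%N.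
Proof.
move=> f alpha0 beta0; split; last first.
  by apply: fmax_le_Nsph => //; exact: le_lt_trans beta_ge beta_lt.
have b1 : beta < 1 by exact: lt_trans beta_lt alpha_lt1.
have [] := @max_sizeP (sph_code_of_size alpha beta d) (d.+1 ^ 2).
- by move=> m; exact: sph_codes_bounded.
(* The empty code makes the family of sizes nonempty, so that its maximum is attained by an actual
   code. *)
- exists 0%N; exists fset0; split; last by rewrite cardfs0.
  by split=> x; rewrite ?inE // => y; rewrite inE.
rewrite -/(Nsph alpha beta d) => /(gram_codeP _ _ alpha_lt1 b1)[X codeX] _.
apply: (gram_code_le _ _ _ codeX) => // i.
by rewrite ler_nat max_degree_le_fmax.
Qed.
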